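(* For every positive integer $m$ and every rational $\alpha\in(-1,1)\setminus\{0\}$, the following summations hold: $$\sum_{j=1}^{\infty}\frac{(2j+2m-1)!}{(2j-1)!}\,\zeta(2j+2m)\,\alpha^{2j-1} = \frac{(2m)!}{2\,\alpha^{2m+1}} + (-1)^m\,\pi\,\frac{(2\pi q)^{2m}}{2m+1}\sum_{s=1}^{q} B_{2m+1}\!\left(\frac{s}{q}\right)\sin(2\pi s\,\widetilde{\alpha})$$ and $$\sum_{j=1}^{\infty}\frac{(2j+2m-1)!}{(2j-2)!}\,\zeta(2j+2m)\,\alpha^{2j-2} = -\frac{(2m+1)!}{2\,\alpha^{2m+2}} + (-1)^m\,\pi\,\frac{(2\pi q)^{2m+1}}{2m+2}\sum_{s=1}^{q} B_{2m+2}\!\left(\frac{s}{q}\right)\cos(2\pi s\,\widetilde{\alpha}),$$ where $\widetilde{\alpha}:=\alpha-\lfloor\alpha\rfloor\in(0,1)$ and $q>1$ is the denominator of $\widetilde{\alpha}$.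
   Context: $\zeta(s)=\sum_{n=1}^{\infty} n^{-s}$ for $s>1$ is the Riemann zeta function. $B_n(x)$ denotes the Bernoulli polynomial of degree $n$, defined by $\frac{t e^{tx}}{e^t-1}=\sum_{n=0}^{\infty} B_n(x)\frac{t^n}{n!}$ for $0<|t|<2\pi$. $\lfloor x\rfloor$ is the greatest integer less than or equal to $x$. The denominator of a rational number is its positive denominator in lowest terms. The convention $0^0=1$ is not needed since $\alpha\neq 0$. *)

(* Defs.v *)
From Stdlib Require Export Factorial QArith Qreals Qround Reals.
From Coquelicot Require Export Coquelicot.

Open Scope R_scope.

(* [Series] is total, so [zeta s] is meaningful only for [1 < s]. *)
Definition zeta (s : R) : R := Series (fun n => / Rpower (INR (S n)) s).

(* [B n x] is the value at [x] of the [n]-th Bernoulli polynomial. Letting [t]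
   range over a real punctured neighbourhood of 0 already determines every
   coefficient, hence [B], uniquely. *)
Definition bernoulli_polynomials (B : nat -> R -> R) : Prop :=
  forall x t : R, 0 < Rabs t < 2 * PI ->
    is_series (fun n => B n x * (t ^ n / INR (fact n)))
              (t * exp (t * x) / (exp t - 1)).

Definition Qfrac (a : Q) : Q := (a - inject_Z (Qfloor a))%Q.

(* [Qden] alone depends on the representative: a [Q] need not be reduced. *)
Definition denominator (a : Q) : nat := Pos.to_nat (Qden (Qred a)).

(* Main.v *)
From Stdlib Require Import Lra Lia.
Require Import Defs.

(** Both series are derivatives of one power series.  Since
    [1/x - PI * cot (PI * x) = sum_(k odd) 2 * zeta (k + 1) * x^k] for
    [0 < |x| < 1], its [2m]-th and [(2m+1)]-th derivatives at [x = alpha] are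
    twice the two series to be summed.  It remains to know the derivatives of
    the cotangent at a rational point, and these are finite sums of Bernoulli
    values because the same recurrence governs both.

    The cotangent expansion ([cot_expansion]) is Herglotz's argument.  The
    power series is the limit of the sums of [1/(n-x) - 1/(n+x)], hence
    [1/x] minus it satisfies the duplication formula
    [F (x/2) + F ((x-1)/2) = 2 * F x] of [PI * cot (PI * x)]; the difference of
    the two is odd, extends continuously to [0], and an odd continuous solution
    of the duplication formula on [[-1/2, 1/2]] vanishes by a maximum principle
    ([odd_duplication_vanishes]).

    Let [E x = exp (2 PI i x)] and [c_n] the [n]-th derivative of
    [PI * cot (PI * x)] divided by [n!].  Differentiating
    [PI * cot (PI * x) * (E x - 1) = i PI (E x + 1)] with Leibniz' rule gives
    ([cot_taylor_recurrence])
    [sum_(i <= n) c_i (E x (2 PI i)^(n-i) / (n-i)! - [i = n])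
       = i PI (E x (2 PI i)^n / n! + [n = 0])].

    On the other side put
    [beta_k = sum_(s = 1..q) B_k (s/q) / k! * w^s] with [w^q = 1].  Shifting
    [s] by one, the addition formula of the Bernoulli polynomials ([bern_addition]) and
    [B_k 1 - B_k 0 = [k = 1]] ([bern_coef_one]) give ([bern_sum_recurrence])
    [beta_k = w * sum_(i <= k) (beta_i - [i = 1]) (1/q)^(k-i) / (k-i)!].

    For [w = E x <> 1] the first recurrence determines [c_n] uniquely, and after
    the rescaling [1/q -> 2 PI i] the second one exhibits a solution, whence
    [c_n = (2 PI i)^(n+1) q^n beta_(n+1)] for [n >= 1]
    ([cot_taylor_bern_sum]).  As [c_n] is real, taking real parts leaves the sine
    sum for even [n] and the cosine sum for odd [n]. *)

(** * Finite sums and elementary series *)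

(** Sums are typed by the carrier of an algebraic structure; the arithmetic
    tactics need the equality at the concrete type. *)
Ltac as_eq T := match goal with |- ?a = ?b => change (@eq T a b) end.

Lemma sum_n_RS (u : nat -> R) (N : nat) : sum_n u (S N) = sum_n u N + u (S N) :> R.
Proof. exact (sum_Sn u N). Qed.

Lemma sum_n_Rminus (u v : nat -> R) (N : nat) :
  sum_n (fun n => u n - v n) N = sum_n u N - sum_n v N :> R.
Proof.
  induction N as [|N IH]; [now rewrite !sum_O |].
  rewrite !sum_n_RS, IH. ring.
Qed.

Lemma sum_n_Rplus (u v : nat -> R) (N : nat) :
  sum_n (fun n => u n + v n) N = sum_n u N + sum_n v N :> R.
Proof. exact (sum_n_plus u v N). Qed.

Lemma sum_n_Rscal (c : R) (u : nat -> R) (N : nat) :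
  sum_n (fun n => c * u n) N = c * sum_n u N :> R.
Proof. exact (sum_n_mult_l c u N). Qed.

Lemma sum_n_head {G : AbelianMonoid} (u : nat -> G) (N : nat) :
  sum_n u (S N) = plus (u 0%nat) (sum_n (fun i => u (S i)) N).
Proof.
  unfold sum_n. rewrite sum_Sn_m by lia. now rewrite sum_n_m_S.
Qed.

Lemma sum_n_CS (u : nat -> C) (N : nat) :
  sum_n u (S N) = (sum_n u N + u (S N))%C :> C.
Proof. exact (sum_Sn u N). Qed.

Lemma sum_n_Cplus (u v : nat -> C) (N : nat) :
  sum_n (fun n => u n + v n)%C N = (sum_n u N + sum_n v N)%C :> C.
Proof. exact (sum_n_plus u v N). Qed.

Lemma sum_n_Cscal (c : C) (u : nat -> C) (N : nat) :
  sum_n (fun n => c * u n)%C N = (c * sum_n u N)%C :> C.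
Proof. exact (sum_n_mult_l c u N). Qed.

Lemma Re_sum_n (u : nat -> C) (N : nat) :
  Re (sum_n u N) = sum_n (fun n => Re (u n)) N.
Proof.
  induction N as [|N IH]; [now rewrite !sum_O |].
  now rewrite sum_Sn, sum_n_RS, <- IH.
Qed.

Lemma Im_sum_n (u : nat -> C) (N : nat) :
  Im (sum_n u N) = sum_n (fun n => Im (u n)) N.
Proof.
  induction N as [|N IH]; [now rewrite !sum_O |].
  now rewrite sum_Sn, sum_n_RS, <- IH.
Qed.

Lemma RtoC_sum_n (u : nat -> R) (N : nat) :
  RtoC (sum_n u N) = sum_n (fun n => RtoC (u n)) N :> C.
Proof.
  induction N as [|N IH]; [now rewrite !sum_O |].
  now rewrite sum_n_RS, sum_n_CS, RtoC_plus, IH.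
Qed.

Lemma sum_n_telescope (u : nat -> C) (N : nat) :
  sum_n (fun s => u (S s)) N = (sum_n u N + u (S N) - u 0%nat)%C :> C.
Proof.
  induction N as [|N IH]; [rewrite !sum_O | rewrite !sum_n_CS, IH]; as_eq C; ring.
Qed.

Definition delta (n : nat) : R := match n with 0%nat => 1 | S _ => 0 end.

Lemma sum_n_delta_l (F : nat -> C) (n : nat) :
  sum_n (fun j => RtoC (delta j) * F j)%C n = F 0%nat :> C.
Proof.
  induction n as [|n IH]; [rewrite sum_O | rewrite sum_n_CS, IH]; as_eq C; simpl delta; ring.
Qed.

Lemma sum_n_delta_rev (F : nat -> C) (n : nat) :
  sum_n (fun j => F j * RtoC (delta (n - j)))%C n = F n :> C.
Proof.
  destruct n as [|n]; [rewrite sum_O; as_eq C; simpl delta; ring |].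
  rewrite sum_n_CS, Nat.sub_diag.
  rewrite (sum_n_ext_loc _ (fun _ => 0 * 0)%C n).
  - rewrite sum_n_Cscal. simpl delta. ring.
  - intros j Hj. rewrite Nat.sub_succ_l by exact Hj. simpl delta. as_eq C. ring.
Qed.

(** Division by a formal power series with nonzero constant term. *)
Lemma convolution_cancel (u v e : nat -> C) :
  e 0%nat <> 0 ->
  (forall n, sum_n (fun i => u i * e (n - i)%nat)%C n
           = sum_n (fun i => v i * e (n - i)%nat)%C n) ->
  forall n, u n = v n.
Proof.
  intros He Hn.
  assert (Hcancel : forall a b : C, (a * e 0%nat)%C = (b * e 0%nat)%C -> a = b).
  { intros a b H.
    transitivity (a * e 0%nat / e 0%nat)%C; [field; exact He |].
    rewrite H. field. exact He. }
  induction n as [n IH] using (well_founded_induction Wf_nat.lt_wf).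
  specialize (Hn n). destruct n as [|n].
  - rewrite !sum_O in Hn. now apply Hcancel.
  - rewrite !sum_n_CS, Nat.sub_diag in Hn. apply Hcancel.
    rewrite (sum_n_ext_loc _ (fun i => v i * e (S n - i)%nat)%C n) in Hn.
    + set (t := sum_n _ n) in Hn.
      transitivity (t + u (S n) * e 0%nat - t)%C; [ring |]. rewrite Hn. ring.
    + intros i Hi. rewrite IH by lia. reflexivity.
Qed.

Lemma is_series_Rscal (c : R) (u : nat -> R) (l : R) :
  is_series u l -> is_series (fun n => c * u n) (c * l).
Proof. exact (is_series_scal c u l). Qed.

Lemma partial_sum_le_limit (u : nat -> R) (l : R) (N : nat) :
  (forall n, 0 <= u n) -> is_series u l -> sum_n u N <= l.
Proof.
  intros Hu Hl.
  apply (is_lim_seq_incr_compare (sum_n u) l).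
  - exact Hl.
  - intros n. rewrite sum_n_RS. specialize (Hu (S n)). lra.
Qed.

(** For a series whose even or whose odd terms all vanish, grouping in pairs removes
    the gaps. *)
Lemma is_series_pairs (u : nat -> R) (l : R) :
  is_series u l -> is_series (fun i => u (2 * i)%nat + u (2 * i + 1)%nat) l.
Proof.
  intros Hu.
  change (is_lim_seq (sum_n (fun i => u (2 * i)%nat + u (2 * i + 1)%nat)) l).
  apply is_lim_seq_ext with (fun N => sum_n u (2 * N + 1)).
  - intros N. induction N as [|N IH].
    + change (2 * 0 + 1)%nat with 1%nat. now rewrite sum_n_RS, !sum_O.
    + replace (2 * S N + 1)%nat with (S (S (2 * N + 1))) by lia.
      rewrite !sum_n_RS, IH.
      replace (2 * S N)%nat with (S (2 * N + 1)) by lia.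
      replace (S (2 * N + 1) + 1)%nat with (S (S (2 * N + 1))) by lia.
      as_eq R. ring.
  - apply (is_lim_seq_subseq (sum_n u) l (fun N => (2 * N + 1)%nat)); [| exact Hu].
    apply eventually_subseq. intros n. lia.
Qed.

Lemma INR_S_ge1 (n : nat) : 1 <= INR (S n).
Proof. rewrite S_INR. assert (H := pos_INR n). lra. Qed.

Lemma INR_S_neq0 (n : nat) : INR (S n) <> 0.
Proof. assert (H := INR_S_ge1 n). lra. Qed.

(** * Integer values of zeta *)

Lemma is_lim_seq_inv_INR_S : is_lim_seq (fun n => / INR (S n)) 0.
Proof.
  apply (is_lim_seq_incr_1 (fun n => / INR n)).
  apply (is_lim_seq_inv INR p_infty is_lim_seq_INR). discriminate.
Qed.

(** Comparison with the telescoping series of [2 / (n (n + 1))]. *)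
Lemma ex_series_inv_squares : ex_series (fun n => / INR (S n) ^ 2).
Proof.
  apply @ex_series_le with (b := fun n => 2 * (/ INR (S n) - / INR (S (S n)))).
  - intros n. change (Rabs (/ INR (S n) ^ 2) <= 2 * (/ INR (S n) - / INR (S (S n)))).
    assert (H := INR_S_ge1 n). rewrite (S_INR (S n)).
    set (y := INR (S n)) in *.
    rewrite Rabs_pos_eq by (left; apply Rinv_0_lt_compat; nra).
    replace (2 * _) with (2 / (y * (y + 1))) by (field; lra).
    apply Rmult_le_reg_r with (y ^ 2 * (y + 1)); [nra |].
    replace (/ _ * _) with (y + 1) by (field; lra).
    replace (2 / _ * _) with (2 * y) by (field; lra).
    lra.
  - apply (ex_series_scal 2 (fun n => / INR (S n) - / INR (S (S n)))). exists 1.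
    change (is_lim_seq (sum_n (fun n => / INR (S n) - / INR (S (S n)))) 1).
    apply is_lim_seq_ext with (fun n => 1 - / INR (S (S n))).
    + intros n. induction n as [|n IH].
      * rewrite sum_O. simpl. field.
      * rewrite sum_n_RS, <- IH. simpl; lra.
    + replace (Finite 1) with (Finite (1 - 0)) by (f_equal; ring).
      apply is_lim_seq_minus'; [apply is_lim_seq_const |].
      apply (is_lim_seq_incr_1 (fun n => / INR (S n))).
      exact is_lim_seq_inv_INR_S.
Qed.

Lemma inv_pow_le_inv_square (n k : nat) :
  (1 <= k)%nat -> 0 <= / INR (S n) ^ S k <= / INR (S n) ^ 2.
Proof.
  intros Hk. assert (H := INR_S_ge1 n). split.
  - left. apply Rinv_0_lt_compat, pow_lt. lra.
  - apply Rinv_le_contravar; [apply pow_lt; lra |].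
    apply Rle_pow; [exact H | lia].
Qed.

Lemma zeta_is_series (k : nat) :
  (1 <= k)%nat -> is_series (fun n => / INR (S n) ^ S k) (zeta (INR (S k))).
Proof.
  intros Hk. unfold zeta.
  rewrite (Series_ext _ (fun n => / INR (S n) ^ S k)).
  - apply Series_correct.
    apply @ex_series_le with (b := fun n => / INR (S n) ^ 2).
    + intros n. change (Rabs (/ INR (S n) ^ S k) <= / INR (S n) ^ 2).
      destruct (inv_pow_le_inv_square n k Hk).
      rewrite Rabs_pos_eq; assumption.
    + exact ex_series_inv_squares.
  - intros n. rewrite Rpower_pow; [reflexivity |].
    assert (H := INR_S_ge1 n). lra.
Qed.

(** All tails are controlled by the one of [zeta 2]: this uniformity in the
    exponent is what allows the limits in [N] and in the power series to be
    exchanged. *)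
Lemma zeta_tail (k N : nat) :
  (1 <= k)%nat ->
  0 <= zeta (INR (S k)) - sum_n (fun n => / INR (S n) ^ S k) N
    <= zeta (INR 2) - sum_n (fun n => / INR (S n) ^ 2) N.
Proof.
  intros Hk.
  assert (Hz := zeta_is_series k Hk).
  assert (H2 := zeta_is_series 1 (le_n 1)).
  assert (Hle := inv_pow_le_inv_square).
  split.
  - assert (H := partial_sum_le_limit _ _ N (fun n => proj1 (Hle n k Hk)) Hz). lra.
  - assert (Hd : is_series (fun n => / INR (S n) ^ 2 - / INR (S n) ^ S k)
                           (zeta (INR 2) - zeta (INR (S k))))
      by exact (is_series_minus _ _ _ _ H2 Hz).
    assert (H := partial_sum_le_limit _ _ N
      (fun n => proj1 (Rminus_le_0 _ _) (proj2 (Hle n k Hk))) Hd).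
    rewrite sum_n_Rminus in H. lra.
Qed.

(** * The odd zeta series as a limit of pairs of simple poles *)

(** Coefficients of [1/x - PI * cot (PI * x)].  The sign factor vanishes for even
    [k], in particular for [k = 0], where [zeta 1] has no meaning. *)
Definition cot_coef (k : nat) : R := (1 - (-1) ^ k) * zeta (INR (S k)).

Lemma sign_factor_bound (k : nat) : 0 <= 1 - (-1) ^ k <= 2.
Proof.
  destruct (Nat.Even_or_Odd k) as [[i ->]|[i ->]].
  - rewrite pow_1_even. lra.
  - rewrite Nat.add_1_r, pow_1_odd. lra.
Qed.

Lemma cot_coef_bound (k : nat) : Rabs (cot_coef k) <= 2 * (zeta (INR 2)).
Proof.
  unfold cot_coef.
  assert (H2 := partial_sum_le_limit _ _ 0 (fun n => proj1 (inv_pow_le_inv_square n 1 (le_n 1)))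
     (zeta_is_series 1 (le_n 1))).
  rewrite sum_O in H2.
  destruct k as [|k].
  - rewrite pow_O. rewrite Rminus_diag, Rmult_0_l, Rabs_R0.
    assert (0 < / INR 1 ^ 2) by (simpl; lra). lra.
  - assert (Ht := zeta_tail (S k) 0 ltac:(lia)). rewrite !sum_O in Ht.
    assert (Hp := proj1 (inv_pow_le_inv_square 0 (S k) ltac:(lia))).
    assert (Hs := sign_factor_bound (S k)).
    replace (/ INR 1 ^ 2) with 1 in * by (simpl; field).
    replace (/ INR 1 ^ S (S k)) with 1 in * by (simpl INR; rewrite pow1; field).
    rewrite Rabs_pos_eq by nra. nra.
Qed.

Lemma CV_radius_cot_coef (x : R) :
  Rabs x < 1 -> Rbar_lt (Rabs x) (CV_radius cot_coef).
Proof.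
  intros Hx. apply Rbar_lt_le_trans with 1; [exact Hx |].
  apply (proj1 (CV_radius_bounded cot_coef)).
  exists (2 * zeta (INR 2)). intros n. rewrite pow1, Rmult_1_r.
  apply cot_coef_bound.
Qed.

Definition pole_pairs (N : nat) (x : R) : R :=
  sum_n (fun n => / (INR (S n) - x) - / (INR (S n) + x)) N.

Lemma pole_pairs_O (x : R) : pole_pairs 0 x = / (1 - x) - / (1 + x).
Proof. unfold pole_pairs. now rewrite sum_O. Qed.

Lemma pole_pairs_S (N : nat) (x : R) :
  pole_pairs (S N) x
  = pole_pairs N x + (/ (INR (S (S N)) - x) - / (INR (S (S N)) + x)).
Proof. apply sum_n_RS. Qed.

Lemma is_series_pole_pair (n : nat) (x : R) :
  Rabs x < 1 ->
  is_series (fun k => (1 - (-1) ^ k) * / INR (S n) ^ S k * x ^ k)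
            (/ (INR (S n) - x) - / (INR (S n) + x)).
Proof.
  intros Hx. assert (Hn := INR_S_ge1 n). set (y := INR (S n)) in *.
  assert (Hxy : Rabs (x / y) < 1).
  { unfold Rdiv. rewrite Rabs_mult, (Rabs_pos_eq (/ y))
      by (left; apply Rinv_0_lt_compat; lra).
    apply Rmult_lt_reg_r with y; [lra |].
    rewrite Rmult_assoc, Rinv_l; lra. }
  assert (Hxy' : Rabs (- (x / y)) < 1) by (rewrite Rabs_Ropp; exact Hxy).
  apply Rabs_def2 in Hx.
  assert (H : is_series (fun k => / y * ((x / y) ^ k - (- (x / y)) ^ k))
                        (/ y * (/ (1 - x / y) - / (1 - - (x / y))))).
  { apply is_series_Rscal.
    exact (is_series_minus _ _ _ _ (is_series_geom _ Hxy) (is_series_geom _ Hxy')). }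
  replace (/ (y - x) - / (y + x))
    with (/ y * (/ (1 - x / y) - / (1 - - (x / y)))) by (field; lra).
  eapply is_series_ext; [| exact H].
  intros k. simpl.
  replace (- (x / y)) with (-1 * (x / y)) by ring.
  unfold Rdiv. rewrite !Rpow_mult_distr, pow_inv, Rinv_mult. ring.
Qed.

Lemma is_series_pole_pairs (N : nat) (x : R) :
  Rabs x < 1 ->
  is_series (fun k => (1 - (-1) ^ k) * sum_n (fun n => / INR (S n) ^ S k) N * x ^ k)
            (pole_pairs N x).
Proof.
  intros Hx. unfold pole_pairs. induction N as [|N IH].
  - rewrite sum_O. eapply is_series_ext; [| exact (is_series_pole_pair 0 x Hx)].
    intros k. now rewrite sum_O.
  - rewrite sum_n_RS.
    apply is_series_ext with (2 := is_series_plus _ _ _ _ IH (is_series_pole_pair (S N) x Hx)).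
    intros k. rewrite sum_n_RS. symmetry.
    rewrite Rmult_plus_distr_l. apply Rmult_plus_distr_r.
Qed.

(** Termwise comparison: the coefficients of the difference are at most twice the
    tail of [zeta 2], so a geometric series bounds it. *)
Lemma PSeries_cot_coef_pole_pairs (N : nat) (x : R) :
  Rabs x < 1 ->
  Rabs (PSeries cot_coef x - pole_pairs N x)
    <= (zeta (INR 2) - sum_n (fun n => / INR (S n) ^ 2) N) * (2 * / (1 - Rabs x)).
Proof.
  intros Hx.
  set (tau := zeta (INR 2) - _).
  assert (H1 : is_series (fun k => cot_coef k * x ^ k) (PSeries cot_coef x)).
  { apply Series_correct.
    destruct (CV_radius_inside _ _ (CV_radius_cot_coef x Hx)) as [l Hl].
    exists l. exact (proj1 (is_pseries_R cot_coef x l) Hl). }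
  assert (Hd : is_series (fun k => cot_coef k * x ^ k +
      - ((1 - (-1) ^ k) * sum_n (fun n => / INR (S n) ^ S k) N * x ^ k))
      (PSeries cot_coef x - pole_pairs N x))
    by exact (is_series_minus _ _ _ _ H1 (is_series_pole_pairs N x Hx)).
  assert (Hg : is_series (fun k => 2 * tau * Rabs x ^ k) (2 * tau * / (1 - Rabs x))).
  { apply is_series_Rscal, is_series_geom. now rewrite Rabs_Rabsolu. }
  assert (Hb : forall k, Rabs (cot_coef k * x ^ k +
      - ((1 - (-1) ^ k) * sum_n (fun n => / INR (S n) ^ S k) N * x ^ k))
      <= 2 * tau * Rabs x ^ k).
  { intros k. unfold cot_coef.
    replace (_ + _) with ((1 - (-1) ^ k) *
        (zeta (INR (S k)) - sum_n (fun n => / INR (S n) ^ S k) N) * x ^ k) by ring.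
    rewrite Rabs_mult, <- RPow_abs.
    apply Rmult_le_compat_r; [apply pow_le, Rabs_pos |].
    destruct k as [|k].
    - rewrite pow_O, Rminus_diag, Rmult_0_l, Rabs_R0.
      assert (H := zeta_tail 1 N (le_n 1)). fold tau in H. lra.
    - assert (H := zeta_tail (S k) N ltac:(lia)). fold tau in H.
      assert (Hs := sign_factor_bound (S k)).
      rewrite Rabs_pos_eq by nra. nra. }
  rewrite <- (is_series_unique _ _ Hd).
  eapply Rle_trans; [apply Series_Rabs |].
  - eapply @ex_series_le; [| exists (2 * tau * / (1 - Rabs x)); exact Hg].
    intros k. change (Rabs (Rabs (cot_coef k * x ^ k +
      - ((1 - (-1) ^ k) * sum_n (fun n => / INR (S n) ^ S k) N * x ^ k)))
      <= 2 * tau * Rabs x ^ k).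
    rewrite Rabs_Rabsolu. apply Hb.
  - replace (tau * _) with (2 * tau * / (1 - Rabs x)) by ring.
    rewrite <- (is_series_unique _ _ Hg).
    apply Series_le; [| eexists; exact Hg].
    intros k. split; [apply Rabs_pos | apply Hb].
Qed.

Lemma is_lim_pole_pairs (x : R) :
  Rabs x < 1 -> is_lim_seq (fun N => pole_pairs N x) (PSeries cot_coef x).
Proof.
  intros Hx.
  set (c := 2 * / (1 - Rabs x)).
  set (tau := fun N => zeta (INR 2) - sum_n (fun n => / INR (S n) ^ 2) N).
  assert (Htau : is_lim_seq (fun N => tau N * c) 0).
  { replace (Finite 0) with (Finite ((zeta (INR 2) - zeta (INR 2)) * c))
      by (f_equal; ring).
    apply (is_lim_seq_scal_r tau c (zeta (INR 2) - zeta (INR 2))).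
    apply is_lim_seq_minus'; [apply is_lim_seq_const |].
    exact (zeta_is_series 1 (le_n 1)). }
  set (p := PSeries cot_coef x).
  apply is_lim_seq_le_le with (u := fun N => p - tau N * c) (w := fun N => p + tau N * c).
  - intros N. assert (H := PSeries_cot_coef_pole_pairs N x Hx).
    apply Rabs_le_between in H. unfold tau, c, p. lra.
  - replace (Finite p) with (Finite (p - 0)) by (f_equal; ring).
    apply is_lim_seq_minus'; [apply is_lim_seq_const | exact Htau].
  - replace (Finite p) with (Finite (p + 0)) by (f_equal; ring).
    apply is_lim_seq_plus'; [apply is_lim_seq_const | exact Htau].
Qed.

Lemma PSeries_cot_coef_odd (x : R) :
  PSeries cot_coef (- x) = - PSeries cot_coef x.
Proof.
  unfold PSeries. rewrite <- Series_opp. apply Series_ext. intros k.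
  unfold cot_coef. replace (- x) with (-1 * x) by ring.
  rewrite Rpow_mult_distr.
  assert (H : (-1) ^ k * (-1) ^ k = 1) by (rewrite <- Rpow_mult_distr, <- (pow1 k); f_equal; ring).
  replace (-1 * x) with (- x) by ring. set (s := (-1) ^ k) in *.
  transitivity ((s - s * s) * zeta (INR (S k)) * x ^ k); [ring |].
  rewrite H. ring.
Qed.

(** * Herglotz's proof of the cotangent expansion *)

(** The poles of the two terms on the left are at the even and at the odd integers
    respectively.  Together they fill the symmetric range of the right-hand side, up to
    one excess pole at [2 N + 3], which disappears in the limit. *)
Lemma pole_pairs_duplication (N : nat) (x : R) :
  0 < x < 1 ->
  (/ (x / 2) - pole_pairs N (x / 2)) + (/ ((x - 1) / 2) - pole_pairs N ((x - 1) / 2))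
  = 2 * (/ x - pole_pairs (2 * N + 1) x) + 2 * / (x - (2 * INR N + 3)).
Proof.
  intros Hx. induction N as [|N IH].
  - change (2 * 0 + 1)%nat with 1%nat.
    rewrite pole_pairs_S, !pole_pairs_O. simpl. field. lra.
  - replace (2 * S N + 1)%nat with (S (S (2 * N + 1))) by lia.
    rewrite !pole_pairs_S.
    match goal with |- / (x / 2) - (?f + ?a) + (/ ((x - 1) / 2) - (?g + ?b)) = _ =>
      transitivity ((/ (x / 2) - f + (/ ((x - 1) / 2) - g)) - (a + b)); [ring |] end.
    rewrite IH.
    rewrite !S_INR, plus_INR, mult_INR. simpl (INR 2). simpl (INR 1).
    assert (H := pos_INR N). field. lra.
Qed.

Lemma PSeries_cot_coef_duplication (x : R) :
  0 < x < 1 ->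
  (/ (x / 2) - PSeries cot_coef (x / 2))
  + (/ ((x - 1) / 2) - PSeries cot_coef ((x - 1) / 2))
  = 2 * (/ x - PSeries cot_coef x).
Proof.
  intros Hx.
  assert (H0 : is_lim_seq (fun N => x - (2 * INR N + 3)) m_infty).
  { apply is_lim_seq_le_m_loc with (u := fun N => - INR N).
    - exists 0%nat. intros n _. assert (H := pos_INR n). lra.
    - exact (proj1 (is_lim_seq_opp INR p_infty) is_lim_seq_INR). }
  assert (H1 : is_lim_seq (fun N => 2 * (/ x - pole_pairs (2 * N + 1) x)
                                    + 2 * / (x - (2 * INR N + 3)))
                 (2 * (/ x - PSeries cot_coef x) + 2 * 0)).
  { apply is_lim_seq_plus'.
    - apply (is_lim_seq_scal_l _ 2 (/ x - PSeries cot_coef x)).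
      apply is_lim_seq_minus'; [apply is_lim_seq_const |].
      apply (is_lim_seq_subseq (fun N => pole_pairs N x) _ (fun N => (2 * N + 1)%nat)).
      + apply eventually_subseq. intros n. lia.
      + apply is_lim_pole_pairs. apply Rabs_def1; lra.
    - apply (is_lim_seq_scal_l _ 2 0).
      apply (is_lim_seq_inv _ m_infty H0). discriminate. }
  assert (H2 : is_lim_seq (fun N => (/ (x / 2) - pole_pairs N (x / 2))
                        + (/ ((x - 1) / 2) - pole_pairs N ((x - 1) / 2)))
      ((/ (x / 2) - PSeries cot_coef (x / 2))
  + (/ ((x - 1) / 2) - PSeries cot_coef ((x - 1) / 2)))).
  { apply is_lim_seq_plus'; (apply is_lim_seq_minus';
      [apply is_lim_seq_const | apply is_lim_pole_pairs; apply Rabs_def1; lra]). }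
  apply (is_lim_seq_ext _ _ _ (fun N => pole_pairs_duplication N x Hx)) in H2.
  apply is_lim_seq_unique in H1. apply is_lim_seq_unique in H2.
  rewrite H2 in H1. injection H1 as H1. lra.
Qed.

(** Minus the cotangent, freed of its pole at [0]; the value [0] there is the limit. *)
Definition cot_defect (x : R) : R :=
  if Req_EM_T x 0 then 0 else / x - PI * cos (PI * x) / sin (PI * x).

Lemma sin_PI_neq0 (x : R) : 0 < Rabs x < 1 -> sin (PI * x) <> 0.
Proof.
  intros Hx. assert (HP := PI_RGT_0).
  destruct (Rcase_abs x) as [Hn|Hn].
  - rewrite (Rabs_left _ Hn) in Hx.
    replace (PI * x) with (- (PI * - x)) by ring. rewrite sin_neg.
    assert (0 < sin (PI * - x)) by (apply sin_gt_0; nra). lra.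
  - rewrite (Rabs_right _ Hn) in Hx.
    assert (0 < sin (PI * x)) by (apply sin_gt_0; nra). lra.
Qed.

Lemma cot_duplication (x : R) :
  0 < x < 1 ->
  PI * cos (PI * (x / 2)) / sin (PI * (x / 2))
  + PI * cos (PI * ((x - 1) / 2)) / sin (PI * ((x - 1) / 2))
  = 2 * (PI * cos (PI * x) / sin (PI * x)).
Proof.
  intros Hx. assert (HP := PI_RGT_0).
  replace (PI * ((x - 1) / 2)) with (PI * (x / 2) - PI / 2) by field.
  rewrite cos_minus, sin_minus, cos_PI2, sin_PI2.
  assert (Hs : 0 < sin (PI * (x / 2))) by (apply sin_gt_0; nra).
  assert (Hc : 0 < cos (PI * (x / 2))) by (apply cos_gt_0; nra).
  replace (PI * x) with (2 * (PI * (x / 2))) by field.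
  rewrite sin_2a, cos_2a. field. lra.
Qed.

(** Maximum principle: where [|g|] is maximal, the duplication formula forces both
    points on its left to be maximal too; iterating [x |-> x / 2] carries the maximum to
    [0], where an odd function vanishes. *)
Lemma odd_duplication_vanishes (g : R -> R) :
  (forall x, -1/2 <= x <= 1/2 -> continuity_pt g x) ->
  (forall x, g (- x) = - g x) ->
  (forall x, 0 < x <= 1/2 -> g (x / 2) + g ((x - 1) / 2) = 2 * g x) ->
  forall x, -1/2 <= x <= 1/2 -> g x = 0.
Proof.
  intros Hc Hodd Hdup.
  assert (H0 : g 0 = 0) by (assert (H := Hodd 0); rewrite Ropp_0 in H; lra).
  assert (Hca : forall x, -1/2 <= x <= 1/2 -> continuity_pt (fun t => Rabs (g t)) x).
  { intros x Hx. apply (continuity_pt_comp g Rabs); [now apply Hc |].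
    apply Rcontinuity_abs. }
  destruct (continuity_ab_maj (fun t => Rabs (g t)) (-1/2) (1/2) ltac:(lra) Hca)
    as [x0 [Hmax Hx0]].
  set (M := Rabs (g x0)) in *.
  assert (Heven : forall x, Rabs (g (Rabs x)) = Rabs (g x)).
  { intros x. destruct (Rcase_abs x) as [Hn|Hn].
    - rewrite (Rabs_left x Hn), Hodd. apply Rabs_Ropp.
    - now rewrite (Rabs_right x Hn). }
  (* By oddness the maximum is also attained at a nonnegative point. *)
  set (x1 := Rabs x0).
  assert (Hx1 : 0 <= x1 <= 1/2).
  { split; [apply Rabs_pos | apply Rabs_le_between; lra]. }
  assert (HM : forall n, M <= Rabs (g (x1 * (1/2) ^ n))).
  { induction n as [|n IH].
    - rewrite pow_O, Rmult_1_r. unfold x1. rewrite Heven. apply Rle_refl.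
    - assert (Hp : 0 < (1/2) ^ n <= 1).
      { split; [apply pow_lt; lra |]. assert (H := pow_incr (1/2) 1 n ltac:(lra)). rewrite pow1 in H. exact H. }
      set (y := x1 * (1/2) ^ n) in *.
      assert (Hy : 0 <= y <= 1/2) by
        (split; [apply Rmult_le_pos; lra |];
         apply Rle_trans with (x1 * 1); [apply Rmult_le_compat_l |]; lra).
      replace (x1 * (1/2) ^ S n) with (y / 2) by (unfold y; simpl; field).
      destruct (Req_dec y 0) as [Hy0|Hy0].
      + rewrite Hy0 in *. now replace (0 / 2) with 0 by field.
      + assert (Hd := Hdup y ltac:(lra)).
        assert (Hm := Hmax ((y - 1) / 2) ltac:(lra)). simpl in Hm.
        assert (Ht := Rabs_triang (g (y / 2)) (g ((y - 1) / 2))).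
        rewrite Hd, Rabs_mult, (Rabs_pos_eq 2) in Ht by lra. lra. }
  assert (Hlim : is_lim_seq (fun n => Rabs (g (x1 * (1/2) ^ n))) (Rabs (g 0))).
  { apply (is_lim_seq_continuous (fun t => Rabs (g t)) (fun n => x1 * (1/2) ^ n)).
    - apply Hca. lra.
    - replace (Finite 0) with (Rbar_mult x1 0) by (simpl; f_equal; ring).
      apply is_lim_seq_scal_l. apply is_lim_seq_geom.
      rewrite Rabs_pos_eq; lra. }
  assert (HM0 : Rbar_le M (Rabs (g 0)))
    by exact (is_lim_seq_le _ _ _ _ HM (is_lim_seq_const M) Hlim).
  rewrite H0, Rabs_R0 in HM0. simpl in HM0.
  intros x Hx. assert (Hm := Hmax x Hx). simpl in Hm.
  assert (Hp := Rabs_pos (g x)).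
  destruct (Req_dec (g x) 0) as [|Hne]; [assumption |].
  apply Rabs_pos_lt in Hne. lra.
Qed.

Lemma sin_le_id (y : R) : 0 <= y -> sin y <= y.
Proof. intros [H| <-]; [left; now apply sin_lt_x | rewrite sin_0; lra]. Qed.

Lemma sin_ge_half (y : R) : 0 <= y <= 1 -> y / 2 <= sin y.
Proof.
  intros Hy. destruct (Req_dec y 0) as [->|Hne]; [rewrite sin_0; lra |].
  destruct (MVT_gen sin 0 y cos) as [c [Hc Heq]].
  - intros x _. apply is_derive_sin.
  - intros x _. apply continuity_sin.
  - rewrite Rmin_left, Rmax_right in Hc by lra.
    rewrite sin_0 in Heq.
    assert (HP := PI2_3_2).
    assert (H : cos (PI / 3) <= cos c) by (apply cos_decr_1; lra).
    rewrite cos_PI3 in H. nra.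
Qed.

(** The derivative of [sin t - t * cos t] is [t * sin t]. *)
Lemma sin_minus_id_cos_bound (y : R) :
  0 <= y <= 1 -> 0 <= sin y - y * cos y <= y ^ 3.
Proof.
  intros Hy. destruct (Req_dec y 0) as [->|Hne]; [rewrite sin_0; simpl; lra |].
  destruct (MVT_gen (fun t => sin t - t * cos t) 0 y (fun t => t * sin t)) as [c [Hc Heq]].
  - intros x _. auto_derive; [exact I | ring].
  - intros x _. apply derivable_continuous_pt.
    apply ex_derive_Reals_0. auto_derive. exact I.
  - rewrite Rmin_left, Rmax_right in Hc by lra.
    rewrite sin_0 in Heq.
    assert (H1 := sin_le_id c ltac:(lra)).
    assert (H2 := sin_ge_half c ltac:(lra)).
    assert (0 <= c * sin c <= y * y) by (split; nra).
    simpl. nra.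
Qed.

Lemma cot_defect_odd (x : R) : cot_defect (- x) = - cot_defect x.
Proof.
  unfold cot_defect.
  destruct (Req_EM_T x 0) as [->|Hx]; destruct (Req_EM_T _ 0) as [H|H]; try lra.
  replace (PI * - x) with (- (PI * x)) by ring.
  rewrite sin_neg, cos_neg. unfold Rdiv. rewrite !Rinv_opp. ring.
Qed.

(** The numerator of [(sin y - y * cos y) / (x * sin y)], [y = PI * x], is at most
    [y^3], while the denominator is at least [x * y / 2]. *)
Lemma cot_defect_bound (x : R) :
  0 < x -> PI * x <= 1 -> Rabs (cot_defect x) <= 2 * PI * PI * x.
Proof.
  intros Hx Hx1. assert (HP := PI_RGT_0). unfold cot_defect.
  destruct (Req_EM_T x 0) as [H|_]; [lra |].
  assert (Hs := sin_ge_half (PI * x) ltac:(nra)).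
  assert (Hn := sin_minus_id_cos_bound (PI * x) ltac:(nra)).
  assert (Hpx : 0 < PI * x) by nra.
  replace (/ x - _) with ((sin (PI * x) - PI * x * cos (PI * x)) / (x * sin (PI * x)))
    by (field; lra).
  assert (Hd : 0 < x * sin (PI * x)) by nra.
  rewrite Rabs_pos_eq.
  - apply Rmult_le_reg_r with (x * sin (PI * x)); [exact Hd |].
    unfold Rdiv. rewrite Rmult_assoc, Rinv_l, Rmult_1_r by lra.
    apply Rle_trans with (1 := proj2 Hn).
    replace ((PI * x) ^ 3) with ((2 * PI * PI * x) * (x * (PI * x / 2))) by field.
    apply Rmult_le_compat_l; [nra |]. apply Rmult_le_compat_l; lra.
  - apply Rmult_le_pos; [lra |]. left. now apply Rinv_0_lt_compat.
Qed.

Lemma cot_defect_continuous (x : R) : Rabs x < 1 -> continuity_pt cot_defect x.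
Proof.
  intros Hx. assert (HP := PI_RGT_0). destruct (Req_dec x 0) as [->|Hne].
  - apply continuity_pt_locally. intros eps.
    assert (Hk : 0 < 2 * PI * PI) by nra.
    assert (Hd : 0 < Rmin (/ PI) (eps / (2 * PI * PI))).
    { apply Rmin_pos; [now apply Rinv_0_lt_compat |].
      apply Rdiv_lt_0_compat; [apply cond_pos | exact Hk]. }
    exists (mkposreal _ Hd). intros y Hy.
    change (Rabs (y - 0) < Rmin (/ PI) (eps / (2 * PI * PI))) in Hy.
    rewrite Rminus_0_r in Hy.
    assert (Hy1 := Rlt_le_trans _ _ _ Hy (Rmin_l _ _)).
    assert (Hy2 := Rlt_le_trans _ _ _ Hy (Rmin_r _ _)). clear Hy Hd.
    replace (cot_defect 0) with 0
      by (unfold cot_defect; destruct (Req_EM_T 0 0); lra).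
    rewrite Rminus_0_r.
    apply (Rmult_lt_compat_l PI) in Hy1; [| exact HP].
    rewrite Rinv_r in Hy1 by lra.
    apply (Rmult_lt_compat_l (2 * PI * PI)) in Hy2; [| exact Hk].
    replace (2 * PI * PI * (eps / (2 * PI * PI))) with (pos eps) in Hy2 by (field; lra).
    apply Rle_lt_trans with (2 := Hy2).
    destruct (Req_dec y 0) as [->|Hy0].
    + unfold cot_defect. destruct (Req_EM_T 0 0); [|lra]. rewrite Rabs_R0. lra.
    + replace (Rabs (cot_defect y)) with (Rabs (cot_defect (Rabs y))).
      * apply cot_defect_bound; [now apply Rabs_pos_lt | lra].
      * destruct (Rcase_abs y) as [Hn|Hn].
        -- rewrite (Rabs_left y Hn), cot_defect_odd. apply Rabs_Ropp.
        -- now rewrite (Rabs_right y Hn).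
  - apply continuity_pt_ext_loc
      with (f := fun t => / t - PI * cos (PI * t) / sin (PI * t)).
    + exists (mkposreal (Rabs x) (Rabs_pos_lt x Hne)). intros y Hy.
      change (Rabs (y - x) < Rabs x) in Hy. unfold cot_defect.
      destruct (Req_EM_T y 0) as [->|]; [| reflexivity].
      rewrite Rminus_0_l, Rabs_Ropp in Hy. lra.
    + assert (Hs := sin_PI_neq0 x (conj (Rabs_pos_lt x Hne) Hx)).
      apply derivable_continuous_pt, ex_derive_Reals_0.
      auto_derive. auto.
Qed.

(** The maximum principle applies on [[-1/2, 1/2]]; one more duplication reaches
    the rest of the unit interval. *)
Lemma cot_expansion (x : R) :
  0 < Rabs x < 1 ->
  PI * cos (PI * x) / sin (PI * x) = / x - PSeries cot_coef x.
Proof.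
  set (g := fun t => cot_defect t - PSeries cot_coef t).
  assert (Hodd : forall t, g (- t) = - g t).
  { intros t. unfold g. rewrite cot_defect_odd, PSeries_cot_coef_odd. ring. }
  assert (Hdup : forall t, 0 < t < 1 -> g (t / 2) + g ((t - 1) / 2) = 2 * g t).
  { intros t Ht. assert (H1 := PSeries_cot_coef_duplication t Ht).
    assert (H2 := cot_duplication t Ht). unfold g, cot_defect.
    destruct (Req_EM_T (t / 2) 0); [lra |].
    destruct (Req_EM_T ((t - 1) / 2) 0); [lra |].
    destruct (Req_EM_T t 0); lra. }
  assert (Hg : forall t, -1/2 <= t <= 1/2 -> g t = 0).
  { apply odd_duplication_vanishes; [| exact Hodd |].
    - intros t Ht. apply continuity_pt_minus.
      + apply cot_defect_continuous. apply Rabs_def1; lra.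
      + apply PSeries_continuity, CV_radius_cot_coef. apply Rabs_def1; lra.
    - intros t Ht. apply Hdup. lra. }
  assert (Hg1 : forall t, 0 < t < 1 -> g t = 0).
  { intros t Ht. assert (H := Hdup t Ht).
    rewrite (Hg (t / 2)), (Hg ((t - 1) / 2)) in H by lra. lra. }
  intros Hx.
  assert (Hgx : g x = 0).
  { destruct (Rcase_abs x) as [Hn|Hn].
    - rewrite (Rabs_left x Hn) in Hx. rewrite <- (Ropp_involutive x), Hodd, (Hg1 _ Hx). ring.
    - rewrite (Rabs_right x Hn) in Hx. now apply Hg1. }
  unfold g, cot_defect in Hgx. destruct (Req_EM_T x 0) as [->|].
  - rewrite Rabs_R0 in Hx. lra.
  - lra.
Qed.

(** * Divided derivatives and Leibniz' rule *)

(** The sequence of the [f^(n) / n!]: with this normalization Leibniz' rule is a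
    plain convolution, without binomial coefficients. *)
Definition divided_derivatives (D : R -> Prop) (f : nat -> R -> R) : Prop :=
  forall n x, D x -> is_derive (f n) x (INR (S n) * f (S n) x).

Lemma divided_derivatives_unique (D : R -> Prop) (f g : nat -> R -> R) :
  open D -> divided_derivatives D f -> divided_derivatives D g ->
  (forall x, D x -> f 0%nat x = g 0%nat x) ->
  forall n x, D x -> f n x = g n x.
Proof.
  intros HD Hf Hg H0. induction n as [|n IH]; intros x Hx; [now apply H0 |].
  apply (Rmult_eq_reg_l (INR (S n))); [| apply INR_S_neq0].
  rewrite <- (is_derive_unique _ _ _ (Hf n x Hx)), <- (is_derive_unique _ _ _ (Hg n x Hx)).
  apply Derive_ext_loc. apply filter_imp with (2 := HD x Hx). exact IH.
Qed.

(** In degree [n + 1] the weight [n + 1] splits as [i + (n + 1 - i)], one summand for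
    each factor of the convolution. *)
Lemma convolution_weight (u v : nat -> R) (n : nat) :
  sum_n (fun i => INR (S i) * u (S i) * v (n - i)%nat
                  + u i * (INR (S (n - i)) * v (S (n - i)))) n
  = INR (S n) * sum_n (fun i => u i * v (S n - i)%nat) (S n).
Proof.
  rewrite <- sum_n_Rscal.
  rewrite (sum_n_ext_loc (fun i => INR (S n) * (u i * v (S n - i)%nat))
    (fun i => INR i * u i * v (S n - i)%nat
              + u i * (INR (S n - i) * v (S n - i)%nat))).
  2:{ intros i Hi. rewrite minus_INR by exact Hi. as_eq R. ring. }
  rewrite !sum_n_Rplus. f_equal.
  - rewrite sum_n_head. change plus with Rplus. simpl (INR 0).
    rewrite !Rmult_0_l, Rplus_0_l. reflexivity.
  - rewrite sum_n_RS, Nat.sub_diag. simpl (INR 0).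
    rewrite Rmult_0_l, Rmult_0_r, Rplus_0_r.
    apply sum_n_ext_loc. intros i Hi. now rewrite Nat.sub_succ_l.
Qed.

(** Leibniz' rule; the product rule in degree [n] produces the weights that
    [convolution_weight] sums up. *)
Lemma divided_derivatives_mult (D : R -> Prop) (f g : nat -> R -> R) :
  divided_derivatives D f -> divided_derivatives D g ->
  divided_derivatives D (fun n x => sum_n (fun i => f i x * g (n - i)%nat x) n).
Proof.
  intros Hf Hg n x Hx.
  rewrite <- (convolution_weight (fun i => f i x) (fun i => g i x)).
  apply (is_derive_sum_n (fun i y => f i y * g (n - i)%nat y)).
  intros i Hi.
  apply (is_derive_mult (f i) (g (n - i)%nat)); [now apply Hf | now apply Hg |].
  intros a b. apply Rmult_comm.
Qed.

Lemma divided_derivatives_PSeries (a : nat -> R) (x : R) (n : nat) :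
  Rbar_lt (Rabs x) (CV_radius a) ->
  is_derive (fun t => PSeries (PS_derive_n n a) t / INR (fact n)) x
    (INR (S n) * (PSeries (PS_derive_n (S n) a) x / INR (fact (S n)))).
Proof.
  intros Hx.
  assert (Hfn := INR_fact_neq_0 n). assert (HSn := INR_S_neq0 n).
  replace (INR (S n) * _) with (/ INR (fact n) * PSeries (PS_derive (PS_derive_n n a)) x).
  - apply is_derive_ext with (fun t => / INR (fact n) * PSeries (PS_derive_n n a) t).
    { intros t. unfold Rdiv. apply Rmult_comm. }
    apply (is_derive_scal (PSeries (PS_derive_n n a)) x (/ INR (fact n))).
    apply is_derive_PSeries. now rewrite CV_radius_derive_n.
  - rewrite (PSeries_ext (PS_derive (PS_derive_n n a)) (PS_derive_n (S n) a)).
    + rewrite fact_simpl, mult_INR. field. now split.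
    + intros k. unfold PS_derive, PS_derive_n.
      rewrite Nat.add_succ_r. simpl (S k + n)%nat.
      rewrite (fact_simpl k), mult_INR. field.
      split; [apply INR_fact_neq_0 | apply INR_S_neq0].
Qed.

(** * The recurrence for the derivatives of the cotangent *)

Definition unit_punctured (x : R) : Prop := 0 < Rabs x < 1.

(** [1/n!] times the [n]-th derivative of [PI * cot (PI * x)], read off from its
    expansion. *)
Definition cot_taylor (n : nat) (x : R) : R :=
  (-1) ^ n / x ^ S n - PSeries (PS_derive_n n cot_coef) x / INR (fact n).

Lemma unit_punctured_open : open unit_punctured.
Proof.
  apply open_and.
  - apply (open_comp Rabs (fun y => 0 < y)).
    + intros x _. apply (continuous_Rabs x).
    + apply open_gt.
  - apply (open_comp Rabs (fun y => y < 1)).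
    + intros x _. apply (continuous_Rabs x).
    + apply open_lt.
Qed.

Lemma cot_taylor_derivatives : divided_derivatives unit_punctured cot_taylor.
Proof.
  intros n x [Hx0 Hx1]. unfold cot_taylor.
  assert (Hx : x <> 0) by (intros ->; rewrite Rabs_R0 in Hx0; lra).
  rewrite Rmult_minus_distr_l.
  apply (is_derive_minus (fun t => (-1) ^ n / t ^ S n)).
  - auto_derive.
    + now apply (pow_nonzero x (S n)).
    + assert (Hp := pow_nonzero x n Hx).
      change (match n with 0%nat => 1 | S _ => INR n + 1 end) with (INR (S n)).
      set (c := INR (S n)). rewrite <- !tech_pow_Rmult. field. now split.
  - now apply divided_derivatives_PSeries, CV_radius_cot_coef.
Qed.

Definition cis (t : R) : C := (cos t, sin t).

Lemma cis_plus (s t : R) : cis (s + t) = (cis s * cis t)%C.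
Proof. unfold cis, Cmult; simpl. rewrite cos_plus, sin_plus. f_equal; ring. Qed.

(** Coefficients of the power series [exp (z * t)] in [t]. *)
Definition exp_coef (z : C) (n : nat) : C := (z ^ n / RtoC (INR (fact n)))%C.

Lemma RtoC_INR_neq0 (n : nat) : n <> 0%nat -> RtoC (INR n) <> 0.
Proof. intros Hn H. apply RtoC_inj in H. now apply (not_0_INR n). Qed.

Lemma exp_coef_S (z : C) (n : nat) :
  (RtoC (INR (S n)) * exp_coef z (S n) = z * exp_coef z n)%C.
Proof.
  unfold exp_coef. rewrite fact_simpl, mult_INR, RtoC_mult, Cpow_S.
  field. split; apply RtoC_INR_neq0; [apply fact_neq_0 | lia].
Qed.

Definition two_PI_i : C := (0, 2 * PI).

Lemma exp_coef_two_PI_i_S (n : nat) :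
  INR (S n) * Re (exp_coef two_PI_i (S n)) = - (2 * PI) * Im (exp_coef two_PI_i n)
  /\ INR (S n) * Im (exp_coef two_PI_i (S n)) = 2 * PI * Re (exp_coef two_PI_i n).
Proof.
  assert (H := exp_coef_S two_PI_i n).
  assert (Hr := f_equal Re H). assert (Hi := f_equal Im H). clear H.
  rewrite re_scal_l, re_mult in Hr. rewrite im_scal_l, im_mult in Hi.
  unfold two_PI_i at 2 3 in Hr. unfold two_PI_i at 2 3 in Hi. simpl in Hr, Hi.
  split; simpl; lra.
Qed.

Lemma C_ext (a b : C) : Re a = Re b -> Im a = Im b -> a = b.
Proof. destruct a, b. simpl. now intros -> ->. Qed.

(** [1/n!] times the [n]-th derivative of [exp (2 PI i x)]. *)
Definition exp_taylor (n : nat) (x : R) : C :=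
  (exp_coef two_PI_i n * cis (2 * PI * x))%C.

Lemma Re_exp_taylor_derivatives (D : R -> Prop) :
  divided_derivatives D (fun n x => Re (exp_taylor n x)).
Proof.
  intros n x _. unfold exp_taylor.
  destruct (exp_coef_two_PI_i_S n) as [Hr Hi].
  rewrite re_mult, Rmult_minus_distr_l, <- !Rmult_assoc, Hr, Hi.
  apply is_derive_ext with (fun t => Re (exp_coef two_PI_i n) * cos (2 * PI * t)
                                   - Im (exp_coef two_PI_i n) * sin (2 * PI * t)).
  - intros t. symmetry. apply re_mult.
  - simpl. auto_derive; [exact I | ring].
Qed.

Lemma Im_exp_taylor_derivatives (D : R -> Prop) :
  divided_derivatives D (fun n x => Im (exp_taylor n x)).
Proof.
  intros n x _. unfold exp_taylor.
  destruct (exp_coef_two_PI_i_S n) as [Hr Hi].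
  rewrite im_mult, Rmult_plus_distr_l, <- !Rmult_assoc, Hr, Hi.
  apply is_derive_ext with (fun t => Re (exp_coef two_PI_i n) * sin (2 * PI * t)
                                   + Im (exp_coef two_PI_i n) * cos (2 * PI * t)).
  - intros t. symmetry. apply im_mult.
  - simpl. auto_derive; [exact I | ring].
Qed.

Lemma divided_derivatives_affine (D : R -> Prop) (f : nat -> R -> R) (a b : R) :
  divided_derivatives D f ->
  divided_derivatives D (fun n x => a * f n x + b * delta n).
Proof.
  intros Hf n x Hx. simpl (delta (S n)).
  replace (INR (S n) * _) with (a * (INR (S n) * f (S n) x) + 0) by ring.
  apply (is_derive_plus (fun t => a * f n t) (fun _ => b * delta n)).
  - apply (is_derive_scal (f n)). now apply Hf.
  - apply (is_derive_const (b * delta n)).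
Qed.

Lemma cot_taylor_0 (x : R) :
  unit_punctured x -> cot_taylor 0 x = PI * cos (PI * x) / sin (PI * x).
Proof.
  intros Hx. rewrite (cot_expansion x Hx). unfold cot_taylor.
  rewrite (PSeries_ext (PS_derive_n 0 cot_coef) cot_coef).
  - simpl. unfold Rdiv. now rewrite Rinv_1, !Rmult_1_r, Rmult_1_l.
  - intros k. unfold PS_derive_n. rewrite Nat.add_0_r. field. apply INR_fact_neq_0.
Qed.

(** For [n = 0] this is the expression of the cotangent by exponentials; both sides
    are divided derivatives, so equality in degree [0] propagates to all degrees. *)
Lemma cot_taylor_recurrence (n : nat) (x : R) :
  unit_punctured x ->
  sum_n (fun i => RtoC (cot_taylor i x)
                  * (exp_taylor (n - i) x - RtoC (delta (n - i))))%C n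
  = (Ci * RtoC PI * (exp_taylor n x + RtoC (delta n)))%C.
Proof.
  intros Hx.
  set (Er := fun n x => 1 * Re (exp_taylor n x) + (-1) * delta n).
  set (Ei := fun n x => 1 * Im (exp_taylor n x) + 0 * delta n).
  set (Pr := fun n x => (- PI) * Im (exp_taylor n x) + 0 * delta n).
  set (Pi := fun n x => PI * Re (exp_taylor n x) + PI * delta n).
  assert (H0 : forall t, exp_taylor 0 t = cis (2 * (PI * t))).
  { intros t. unfold exp_taylor, exp_coef. simpl fact. simpl INR.
    rewrite Rmult_assoc. simpl Cpow. field. }
  apply C_ext.
  - rewrite Re_sum_n.
    transitivity (sum_n (fun i => cot_taylor i x * Er (n - i)%nat x) n).
    { apply sum_n_ext. intros i. rewrite re_scal_l. unfold Er. simpl. ring. }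
    transitivity (Pr n x).
    2:{ unfold Pr. simpl. ring. }
    revert n x Hx.
    apply (divided_derivatives_unique unit_punctured
            (fun n x => sum_n (fun i => cot_taylor i x * Er (n - i)%nat x) n) Pr unit_punctured_open).
    + apply divided_derivatives_mult; [exact cot_taylor_derivatives |].
      apply divided_derivatives_affine, Re_exp_taylor_derivatives.
    + apply divided_derivatives_affine, Im_exp_taylor_derivatives.
    + intros t Ht. rewrite sum_O. unfold Er, Pr. change (0 - 0)%nat with 0%nat. rewrite H0, (cot_taylor_0 t Ht).
      assert (Hs := sin_PI_neq0 t Ht). simpl (delta _). unfold cis, Re, Im; simpl fst; simpl snd.
      rewrite sin_2a, cos_2a_sin. field. exact Hs.
  - rewrite Im_sum_n.
    transitivity (sum_n (fun i => cot_taylor i x * Ei (n - i)%nat x) n).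
    { apply sum_n_ext. intros i. rewrite im_scal_l. unfold Ei. simpl. ring. }
    transitivity (Pi n x).
    2:{ unfold Pi. simpl. ring. }
    revert n x Hx.
    apply (divided_derivatives_unique unit_punctured
            (fun n x => sum_n (fun i => cot_taylor i x * Ei (n - i)%nat x) n) Pi unit_punctured_open).
    + apply divided_derivatives_mult; [exact cot_taylor_derivatives |].
      apply divided_derivatives_affine, Im_exp_taylor_derivatives.
    + apply divided_derivatives_affine, Re_exp_taylor_derivatives.
    + intros t Ht. rewrite sum_O. unfold Ei, Pi. change (0 - 0)%nat with 0%nat. rewrite H0, (cot_taylor_0 t Ht).
      assert (Hs := sin_PI_neq0 t Ht). simpl (delta _). unfold cis, Re, Im; simpl fst; simpl snd.
      rewrite sin_2a, cos_2a_cos. field. exact Hs.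
Qed.

(** * Bernoulli polynomials from their generating function *)

Lemma CV_radius_ge (a : nat -> R) (r : R) :
  0 < r -> ex_series (fun n => a n * r ^ n) -> Rbar_le r (CV_radius a).
Proof.
  intros Hr Ha. apply Rbar_not_lt_le. intros H.
  apply (CV_disk_outside a r).
  - now rewrite (Rabs_pos_eq r) by lra.
  - now apply ex_series_lim_0.
Qed.

(** The generating function of the Bernoulli polynomials says nothing at [t = 0], so
    the usual uniqueness of power series does not apply as it stands. *)
Lemma PSeries_unique_punctured (a b : nat -> R) (r : R) :
  0 < r -> Rbar_lt 0 (CV_radius a) -> Rbar_lt 0 (CV_radius b) ->
  (forall t, 0 < Rabs t < r -> PSeries a t = PSeries b t) ->
  forall n, a n = b n.
Proof.
  intros Hr Ha Hb Hab n.
  (* Multiplied by [t], both series agree at [t = 0] as well. *)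
  apply (PSeries_ext_recip (PS_incr_1 a) (PS_incr_1 b) (S n)).
  - now rewrite CV_radius_incr_1.
  - now rewrite CV_radius_incr_1.
  - exists (mkposreal r Hr). intros t Ht.
    change (Rabs (t - 0) < r) in Ht. rewrite Rminus_0_r in Ht.
    rewrite !PSeries_incr_1. destruct (Req_dec t 0) as [->|Hne]; [ring |].
    rewrite Hab; [reflexivity |]. split; [now apply Rabs_pos_lt | exact Ht].
Qed.

Lemma is_series_delta_pow (t : R) : is_series (fun n => delta n * t ^ n) 1.
Proof.
  change (is_lim_seq (sum_n (fun n => delta n * t ^ n)) 1).
  apply is_lim_seq_ext with (fun _ => 1); [| apply is_lim_seq_const].
  intros n. induction n as [|n IH].
  - rewrite sum_O. simpl. ring.
  - rewrite sum_n_RS, <- IH. simpl. ring.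
Qed.

Lemma is_series_exp (y t : R) :
  is_series (fun n => y ^ n / INR (fact n) * t ^ n) (exp (t * y)).
Proof.
  apply is_series_ext with (2 := proj1 (is_pseries_R _ _ _) (is_exp_Reals (t * y))).
  intros n. as_eq R. rewrite Rpow_mult_distr. unfold Rdiv. ring.
Qed.

Definition bern_coef (B : nat -> R -> R) (x : R) (n : nat) : R :=
  B n x / INR (fact n).

Lemma bern_is_series (B : nat -> R -> R) (x t : R) :
  bernoulli_polynomials B -> 0 < Rabs t < 2 * PI ->
  is_series (fun n => bern_coef B x n * t ^ n) (t * exp (t * x) / (exp t - 1)).
Proof.
  intros HB Ht. apply is_series_ext with (2 := HB x t Ht).
  intros n. as_eq R. unfold bern_coef, Rdiv. ring.
Qed.

Lemma bern_PSeries (B : nat -> R -> R) (x t : R) :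
  bernoulli_polynomials B -> 0 < Rabs t < 2 * PI ->
  PSeries (bern_coef B x) t = t * exp (t * x) / (exp t - 1).
Proof. intros HB Ht. now apply is_series_unique, bern_is_series. Qed.

Lemma bern_CV_radius (B : nat -> R -> R) (x : R) :
  bernoulli_polynomials B -> Rbar_lt 1 (CV_radius (bern_coef B x)).
Proof.
  intros HB. assert (HP := PI2_1).
  apply Rbar_lt_le_trans with 2; [simpl; lra |].
  apply CV_radius_ge; [lra |]. eexists. apply bern_is_series; [exact HB |].
  rewrite Rabs_pos_eq; lra.
Qed.

Lemma exp_CV_radius (y : R) :
  Rbar_lt 1 (CV_radius (fun n => y ^ n / INR (fact n))).
Proof.
  apply Rbar_lt_le_trans with 2; [simpl; lra |].
  apply CV_radius_ge; [lra |]. eexists. apply is_series_exp.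
Qed.

Lemma exp_minus_1_neq0 (t : R) : t <> 0 -> exp t - 1 <> 0.
Proof.
  intros Ht H. apply Ht. apply exp_inv. rewrite exp_0. lra.
Qed.

Lemma Rbar_lt_0_of_1 (r : Rbar) : Rbar_lt 1 r -> Rbar_lt 0 r.
Proof. apply Rbar_lt_trans. simpl. lra. Qed.

(** The generating function at [x + y] is the one at [x] times [exp (t * y)]. *)
Lemma bern_addition (B : nat -> R -> R) (x y : R) (k : nat) :
  bernoulli_polynomials B ->
  bern_coef B (x + y) k
  = sum_n (fun i => bern_coef B x i * (y ^ (k - i) / INR (fact (k - i)))) k.
Proof.
  intros HB. rewrite sum_n_Reals.
  set (e := fun n => y ^ n / INR (fact n)).
  change (bern_coef B (x + y) k = PS_mult (bern_coef B x) e k).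
  assert (HPI := PI2_1).
  assert (Hin : forall a t, Rabs t < 1 -> Rbar_lt 1 (CV_radius a) -> Rbar_lt (Rabs t) (CV_radius a)).
  { intros a t Ht. apply Rbar_lt_trans. exact Ht. }
  apply (PSeries_unique_punctured _ _ 1 Rlt_0_1).
  - now apply Rbar_lt_0_of_1, bern_CV_radius.
  - apply Rbar_lt_le_trans with (1/2); [simpl; lra |]. apply CV_radius_ge; [lra |].
    destruct (ex_pseries_mult (bern_coef B x) e (1/2)) as [l Hl].
    + apply Hin; [rewrite Rabs_pos_eq; lra | now apply bern_CV_radius].
    + apply Hin; [rewrite Rabs_pos_eq; lra | apply exp_CV_radius].
    + exists l. exact (proj1 (is_pseries_R _ _ _) Hl).
  - intros t Ht.
    rewrite (PSeries_mult _ e t (Hin _ _ (proj2 Ht) (bern_CV_radius B x HB))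
                                (Hin _ _ (proj2 Ht) (exp_CV_radius y))).
    rewrite !bern_PSeries by (auto; lra).
    rewrite (is_series_unique _ _ (is_series_exp y t) : PSeries e t = exp (t * y)).
    rewrite Rmult_plus_distr_l, exp_plus. unfold Rdiv. ring.
Qed.

(** The generating functions at [1] and at [0] differ by [t]. *)
Lemma bern_coef_one (B : nat -> R -> R) (k : nat) :
  bernoulli_polynomials B ->
  bern_coef B 1 k = bern_coef B 0 k + PS_incr_1 delta k.
Proof.
  intros HB. assert (HPI := PI2_1).
  revert k.
  change (forall n, bern_coef B 1 n = PS_plus (bern_coef B 0) (PS_incr_1 delta) n).
  apply (PSeries_unique_punctured _ _ 1 Rlt_0_1).
    - now apply Rbar_lt_0_of_1, bern_CV_radius.
    - eapply Rbar_lt_le_trans; [| apply CV_radius_plus].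
      apply Rbar_min_case.
      + now apply Rbar_lt_0_of_1, bern_CV_radius.
      + rewrite CV_radius_incr_1.
        apply Rbar_lt_le_trans with 1; [simpl; lra |]. apply CV_radius_ge; [lra |].
        exists 1. apply is_series_delta_pow.
    - intros t Ht.
      assert (Hb : ex_pseries (bern_coef B 0) t).
      { apply CV_radius_inside.
        apply Rbar_lt_trans with 1; [exact (proj2 Ht) | now apply bern_CV_radius]. }
      assert (Hd : ex_pseries (PS_incr_1 delta) t).
      { exists (t * 1).
        exact (is_pseries_incr_1 delta t 1
                 (proj2 (is_pseries_R delta t 1) (is_series_delta_pow t))). }
      rewrite (PSeries_plus _ _ t Hb Hd), PSeries_incr_1.
      rewrite (bern_PSeries B 0 t HB), (bern_PSeries B 1 t HB) by lra.
      rewrite (is_series_unique _ _ (is_series_delta_pow t) : PSeries delta t = 1).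
      rewrite Rmult_0_r, exp_0, !Rmult_1_r.
      assert (He : exp t - 1 <> 0).
      { apply exp_minus_1_neq0. intros ->. rewrite Rabs_R0 in Ht. lra. }
      field. exact He.
Qed.

Lemma exp_coef_RtoC (y : R) (n : nat) :
  exp_coef (RtoC y) n = RtoC (y ^ n / INR (fact n)).
Proof.
  unfold exp_coef. now rewrite RtoC_div, RtoC_pow by apply INR_fact_neq_0.
Qed.

(** * Bernoulli sums twisted by a root of unity *)

Definition bern_sum (B : nat -> R -> R) (q : nat) (theta : R) (k : nat) : C :=
  sum_n_m (fun s => RtoC (bern_coef B (INR s / INR q) k) * cis (theta * INR s))%C 1 q.

(** The addition formula with step [1/q] expresses the values at [(s + 1) / q] by
    those at [s / q]; as the twist has period [q], the shifted sum is the original one up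
    to the factor [cis theta] and the boundary term [B_i 1 - B_i 0]. *)
Lemma bern_sum_recurrence (B : nat -> R -> R) (q : nat) (theta : R) (k : nat) :
  bernoulli_polynomials B -> (0 < q)%nat -> cis (theta * INR q) = 1 ->
  bern_sum B q theta k
  = (cis theta * sum_n (fun i => (bern_sum B q theta i - RtoC (PS_incr_1 delta i))
                                 * exp_coef (RtoC (/ INR q)) (k - i)) k)%C.
Proof.
  intros HB Hq Hper. destruct q as [|Q]; [lia |].
  assert (HQ := INR_S_neq0 Q).
  assert (Hsum : forall i, bern_sum B (S Q) theta i
    = sum_n (fun s => RtoC (bern_coef B (INR (S s) / INR (S Q)) i) * cis (theta * INR (S s)))%C Q).
  { intros i. unfold bern_sum. now rewrite <- sum_n_m_S. }
  assert (Hshift : forall i, (bern_sum B (S Q) theta i - RtoC (PS_incr_1 delta i))%C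
    = sum_n (fun s => RtoC (bern_coef B (INR s / INR (S Q)) i) * cis (theta * INR s))%C Q).
  { intros i. rewrite Hsum.
    rewrite (sum_n_telescope
      (fun s => RtoC (bern_coef B (INR s / INR (S Q)) i) * cis (theta * INR s))%C).
    rewrite Hper. replace (INR (S Q) / INR (S Q)) with 1 by (field; exact HQ).
    simpl (INR 0). replace (0 / INR (S Q)) with 0 by (field; exact HQ).
    rewrite (bern_coef_one B i HB), RtoC_plus, Rmult_0_r.
    replace (cis 0) with (RtoC 1) by (unfold cis; now rewrite cos_0, sin_0).
    ring. }
  rewrite (sum_n_ext _ (fun i => sum_n (fun s =>
      (RtoC (bern_coef B (INR s / INR (S Q)) i) * cis (theta * INR s))
      * exp_coef (RtoC (/ INR (S Q))) (k - i))%C Q)).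
  2:{ intros i. rewrite Hshift. symmetry.
      apply (sum_n_mult_r (K := C_Ring) (exp_coef (RtoC (/ INR (S Q))) (k - i))). }
  rewrite (sum_n_switch (fun i s => (RtoC (bern_coef B (INR s / INR (S Q)) i) * cis (theta * INR s))
      * exp_coef (RtoC (/ INR (S Q))) (k - i))%C k Q).
  rewrite <- sum_n_Cscal, Hsum. apply sum_n_ext. intros s.
  replace (INR (S s) / INR (S Q)) with (INR s / INR (S Q) + / INR (S Q))
    by (rewrite (S_INR s); field; exact HQ).
  rewrite (bern_addition B _ _ k HB), RtoC_sum_n.
  replace (theta * INR (S s)) with (theta + theta * INR s) by (rewrite S_INR; ring).
  rewrite cis_plus.
  set (u := fun i => RtoC (bern_coef B (INR s / INR (S Q)) i
                           * ((/ INR (S Q)) ^ (k - i) / INR (fact (k - i))))).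
  transitivity (cis theta * sum_n (fun i => cis (theta * INR s) * u i) k)%C.
  - rewrite sum_n_Cscal. unfold u. as_eq C. ring.
  - f_equal. apply sum_n_ext. intros i.
    unfold u. rewrite exp_coef_RtoC, RtoC_mult. as_eq C. ring.
Qed.

Lemma exp_coef_scale (z w : C) (n : nat) :
  (z ^ n * exp_coef w n)%C = exp_coef (z * w) n.
Proof. unfold exp_coef. rewrite Cpow_mult_l. unfold Cdiv. ring. Qed.

Lemma two_PI_i_half : (two_PI_i / 2)%C = (Ci * RtoC PI)%C.
Proof. unfold two_PI_i, Ci, Cdiv, Cmult, Cinv, RtoC; simpl. f_equal; field. Qed.

Lemma cis_neq1 (x : R) : unit_punctured x -> cis (2 * PI * x) <> 1.
Proof.
  intros Hx H. assert (Hs := sin_PI_neq0 x Hx).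
  apply (f_equal Re) in H. simpl in H. rewrite Rmult_assoc, cos_2a_sin in H. nra.
Qed.

(** The twisted Bernoulli sums, shifted by one degree and rescaled, solve the linear
    recurrence that determines the derivatives of the cotangent. *)
Lemma cot_taylor_bern_sum (B : nat -> R -> R) (q : nat) (theta x : R) (n : nat) :
  bernoulli_polynomials B -> (0 < q)%nat -> cis (theta * INR q) = 1 ->
  unit_punctured x -> cis theta = cis (2 * PI * x) ->
  RtoC (cot_taylor n x)
  = (two_PI_i * ((two_PI_i * RtoC (INR q)) ^ n
                 * (bern_sum B q theta (S n) - RtoC (delta n))
                 + RtoC (delta n) / 2))%C.
Proof.
  intros HB Hq Hper Hx Htheta.
  set (z := two_PI_i). set (l := (z * RtoC (INR q))%C).
  set (beta := bern_sum B q theta).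
  assert (Hw := cis_neq1 x Hx). rewrite <- Htheta in Hw.
  assert (Hrec := fun k => bern_sum_recurrence B q theta k HB Hq Hper).
  fold beta in Hrec. set (w := cis theta) in *.
  set (ey := exp_coef (RtoC (/ INR q))) in *.
  assert (Hey0 : ey 0%nat = 1).
  { unfold ey, exp_coef. simpl. field. }
  (* In degree [0] the recurrence reads [beta_0 = w * beta_0]. *)
  assert (Hb0 : beta 0%nat = 0).
  { assert (H : beta 0%nat = (w * ((beta 0%nat - 0) * 1))%C).
    { rewrite <- Hey0. pattern (beta 0%nat) at 1. rewrite (Hrec 0%nat), sum_O. reflexivity. }
    assert (H1 : (1 - w)%C <> 0).
    { intros H1. apply Hw. transitivity (1 - (1 - w))%C; [ring | rewrite H1; ring]. }
    assert (H2 : ((1 - w) * beta 0%nat = 0)%C).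
    { transitivity (beta 0%nat - w * ((beta 0%nat - 0) * 1))%C; [ring |].
      rewrite <- H. ring. }
    transitivity ((1 - w) * beta 0%nat / (1 - w))%C; [| rewrite H2]; field; exact H1. }
  (* Since [beta_0 = 0], the recurrence only involves the shifted sequence [h]. *)
  set (h := fun j => (beta (S j) - RtoC (delta j))%C).
  assert (Hh : forall k, beta (S k) = (w * sum_n (fun j => h j * ey (k - j)%nat) k)%C).
  { intros k. rewrite (Hrec (S k)), sum_n_head. rewrite Hb0.
    change (PS_incr_1 delta 0) with 0. change plus with Cplus.
    unfold h. simpl. ring. }
  assert (Hex : forall j, exp_taylor j x = (w * (l ^ j * ey j))%C).
  { intros j. unfold exp_taylor, ey. rewrite exp_coef_scale, <- Htheta. fold w.
    replace (l * RtoC (/ INR q))%C with z; [unfold z; ring |].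
    unfold l. rewrite RtoC_inv by (apply not_0_INR; lia).
    field. apply RtoC_INR_neq0. lia. }
  revert n.
  apply (convolution_cancel _ (fun n => z * (l ^ n * h n + RtoC (delta n) / 2))%C
          (fun j => exp_taylor j x - RtoC (delta j))%C).
  - rewrite Hex, Hey0. simpl. intros H. apply Hw.
    transitivity (w * (1 * 1) - 1 + 1)%C; [ring | rewrite H; ring].
  - intros n. rewrite (cot_taylor_recurrence n x Hx), <- two_PI_i_half. fold z.
    (* [z / 2 * delta] in the candidate solution turns the right-hand side
       [z * E] of the Bernoulli recurrence into [z / 2 * (E + delta)]. *)
    rewrite (sum_n_ext_loc _ (fun j =>
       z * w * l ^ n * (h j * ey (n - j)%nat)
       + (z / 2 * (RtoC (delta j) * exp_taylor (n - j) x)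
          + (-1) * (z * (l ^ j * h j + RtoC (delta j) / 2) * RtoC (delta (n - j)))))%C n).
    2:{ intros j Hj. rewrite Hex.
        replace (l ^ n)%C with (l ^ j * l ^ (n - j))%C
          by (rewrite <- Cpow_add_r; f_equal; lia).
        as_eq C. field. }
    rewrite !sum_n_Cplus, !sum_n_Cscal.
    rewrite (sum_n_delta_l (fun j => exp_taylor (n - j) x)), Nat.sub_0_r.
    rewrite (sum_n_delta_rev (fun j => z * (l ^ j * h j + RtoC (delta j) / 2))%C).
    replace (z * w * l ^ n * sum_n (fun j => h j * ey (n - j)%nat) n)%C
      with (z * l ^ n * beta (S n))%C by (rewrite Hh; ring).
    unfold h.
    destruct n as [|n]; simpl delta; simpl Cpow; as_eq C; field.
Qed.

(** * Summation of the two series *)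

(** The [n]-fold termwise derivative of the expansion of [1/x - PI * cot (PI * x)]. *)
Lemma is_series_cot_derivative (n : nat) (x : R) :
  unit_punctured x ->
  is_series (fun k => INR (fact (k + n)) / INR (fact k) * cot_coef (k + n) * x ^ k)
            (INR (fact n) * ((-1) ^ n / x ^ S n - cot_taylor n x)).
Proof.
  intros Hx. unfold cot_taylor.
  replace (INR (fact n) * _) with (PSeries (PS_derive_n n cot_coef) x)
    by (field; split; [apply INR_fact_neq_0 |];
        apply pow_nonzero; intros ->; destruct Hx as [H _]; rewrite Rabs_R0 in H; lra).
  apply Series_correct.
  destruct (CV_radius_inside (PS_derive_n n cot_coef) x) as [l Hl].
  - rewrite CV_radius_derive_n. apply CV_radius_cot_coef, Hx.
  - exists l. exact (proj1 (is_pseries_R _ _ _) Hl).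
Qed.

Lemma cot_coef_even (i : nat) : cot_coef (2 * i) = 0.
Proof. unfold cot_coef. rewrite pow_1_even. ring. Qed.

Lemma cot_coef_odd (i : nat) : cot_coef (S (2 * i)) = 2 * zeta (INR (2 * i + 2)).
Proof.
  unfold cot_coef. rewrite pow_1_odd.
  replace (S (S (2 * i))) with (2 * i + 2)%nat by lia. ring.
Qed.

Lemma two_PI_i_pow (q m : nat) :
  ((two_PI_i * RtoC (INR q)) ^ (2 * m))%C = RtoC ((-1) ^ m * (2 * PI * INR q) ^ (2 * m)).
Proof.
  rewrite Cpow_mult_r, pow_mult, <- Rpow_mult_distr, RtoC_pow. f_equal.
  rewrite Cpow_S, Cpow_1_r. unfold two_PI_i, Cmult, RtoC. simpl. f_equal; ring.
Qed.

Lemma cis_2PI_Z (k : Z) : cis (2 * PI * IZR k) = 1.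
Proof.
  assert (H : sin (PI * IZR k) = 0) by (apply sin_eq_0_1; exists k; ring).
  unfold cis. rewrite Rmult_assoc, sin_2a, cos_2a_sin, H. unfold RtoC. f_equal; ring.
Qed.

Lemma Re_bern_sum (B : nat -> R -> R) (q : nat) (t : R) (k : nat) :
  (0 < q)%nat ->
  Re (bern_sum B q (2 * PI * t) k)
  = sum_n_m (fun s => B k (INR s / INR q) * cos (2 * PI * INR s * t)) 1 q / INR (fact k).
Proof.
  intros Hq. destruct q as [|Q]; [lia |]. unfold bern_sum.
  rewrite <- !sum_n_m_S.
  change (sum_n_m ?f 0 Q) with (sum_n f Q).
  match goal with |- _ = ?X / ?d =>
    transitivity (/ d * X); [| unfold Rdiv; apply Rmult_comm] end.
  rewrite Re_sum_n, <- sum_n_Rscal. apply sum_n_ext. intros s.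
  rewrite re_scal_l. unfold bern_coef, Rdiv.
  change (Re (cis ?u)) with (cos u).
  replace (2 * PI * t * INR (S s)) with (2 * PI * INR (S s) * t) by ring.
  as_eq R. ring.
Qed.

Lemma Im_bern_sum (B : nat -> R -> R) (q : nat) (t : R) (k : nat) :
  (0 < q)%nat ->
  Im (bern_sum B q (2 * PI * t) k)
  = sum_n_m (fun s => B k (INR s / INR q) * sin (2 * PI * INR s * t)) 1 q / INR (fact k).
Proof.
  intros Hq. destruct q as [|Q]; [lia |]. unfold bern_sum.
  rewrite <- !sum_n_m_S.
  change (sum_n_m ?f 0 Q) with (sum_n f Q).
  match goal with |- _ = ?X / ?d =>
    transitivity (/ d * X); [| unfold Rdiv; apply Rmult_comm] end.
  rewrite Im_sum_n, <- sum_n_Rscal. apply sum_n_ext. intros s.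
  rewrite im_scal_l. unfold bern_coef, Rdiv.
  change (Im (cis ?u)) with (sin u).
  replace (2 * PI * t * INR (S s)) with (2 * PI * INR (S s) * t) by ring.
  as_eq R. ring.
Qed.

(** Only [exp (2 PI i alpha)] matters, so [alpha] may be replaced by its fractional
    part. *)
Lemma cis_Qfrac (alpha : Q) :
  cis (2 * PI * Q2R (Qfrac alpha)) = cis (2 * PI * Q2R alpha).
Proof.
  unfold Qfrac. rewrite Q2R_minus.
  replace (Q2R (inject_Z (Qfloor alpha))) with (IZR (Qfloor alpha))
    by (unfold Q2R; simpl; field).
  set (k := Qfloor alpha).
  replace (2 * PI * Q2R alpha)
    with (2 * PI * (Q2R alpha - IZR k) + 2 * PI * IZR k) by ring.
  rewrite cis_plus, cis_2PI_Z. ring.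
Qed.

Lemma cis_denominator (x : Q) : cis (2 * PI * Q2R x * INR (denominator x)) = 1.
Proof.
  unfold denominator. rewrite <- (Qeq_eqR _ _ (Qred_correct x)).
  unfold Q2R. rewrite INR_IPR. change (IPR (Qden (Qred x))) with (IZR (Zpos (Qden (Qred x)))).
  rewrite <- (cis_2PI_Z (Qnum (Qred x))). f_equal. field.
  apply not_0_IZR. discriminate.
Qed.

Lemma Q2R_unit_punctured (alpha : Q) :
  (-1 < alpha < 1)%Q -> ~ (alpha == 0)%Q -> unit_punctured (Q2R alpha).
Proof.
  intros [Hl Hu] H0. apply Qlt_Rlt in Hl, Hu.
  replace (Q2R (-1)) with (-1) in Hl by (unfold Q2R; simpl; field).
  replace (Q2R 1) with 1 in Hu by (unfold Q2R; simpl; field).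
  split.
  - apply Rabs_pos_lt. intros H. apply H0. apply eqR_Qeq. rewrite H.
    unfold Q2R. simpl. ring.
  - apply Rabs_def1; lra.
Qed.

Theorem corollary4 (m : nat) (hm : (0 < m)%nat)
  (alpha : Q) (halpha : (-1 < alpha < 1)%Q) (halpha0 : ~ (alpha == 0)%Q)
  (B : nat -> R -> R) (hB : bernoulli_polynomials B) :
  let a := Q2R alpha in
  let alpha' := Q2R (Qfrac alpha) in
  let q := denominator (Qfrac alpha) in
  is_series
    (fun i => let j := S i in
       INR (fact (2 * j + 2 * m - 1)) / INR (fact (2 * j - 1))
       * zeta (INR (2 * j + 2 * m)) * a ^ (2 * j - 1))
    (INR (fact (2 * m)) / (2 * a ^ (2 * m + 1))
     + (-1) ^ m * PI * ((2 * PI * INR q) ^ (2 * m) / INR (2 * m + 1))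
       * sum_n_m (fun s => B (2 * m + 1)%nat (INR s / INR q)
                           * sin (2 * PI * INR s * alpha')) 1 q)
  /\
  is_series
    (fun i => let j := S i in
       INR (fact (2 * j + 2 * m - 1)) / INR (fact (2 * j - 2))
       * zeta (INR (2 * j + 2 * m)) * a ^ (2 * j - 2))
    (- (INR (fact (2 * m + 1)) / (2 * a ^ (2 * m + 2)))
     + (-1) ^ m * PI * ((2 * PI * INR q) ^ (2 * m + 1) / INR (2 * m + 2))
       * sum_n_m (fun s => B (2 * m + 2)%nat (INR s / INR q)
                           * cos (2 * PI * INR s * alpha')) 1 q).
Proof.
  intros a alpha' q.
  assert (Ha : unit_punctured a) by now apply Q2R_unit_punctured.
  assert (Ha0 : a <> 0) by (intros H; destruct Ha as [Ha _]; rewrite H, Rabs_R0 in Ha; lra).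
  assert (Hq : (0 < q)%nat) by apply Pos2Nat.is_pos.
  assert (Hc := fun n => cot_taylor_bern_sum B q (2 * PI * alpha') a n hB Hq
                           (cis_denominator _) Ha (cis_Qfrac alpha)).
  split.
  - set (A := sum_n_m _ 1 q).
    assert (Hval : cot_taylor (2 * m) a
      = - (2 * PI * ((-1) ^ m * (2 * PI * INR q) ^ (2 * m)) * (A / INR (fact (2 * m + 1))))).
    { specialize (Hc (2 * m)%nat). apply (f_equal Re) in Hc.
      rewrite re_RtoC, two_PI_i_pow in Hc. rewrite Hc.
      replace (delta (2 * m)) with 0 by (destruct m; [lia | reflexivity]).
      replace (S (2 * m)) with (2 * m + 1)%nat by lia.
      unfold A. rewrite <- (Im_bern_sum B q alpha' (2 * m + 1) Hq).
      set (beta := bern_sum _ _ _ _). unfold two_PI_i, Re, Im. simpl. field. }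
    assert (Hs := is_series_Rscal (/ 2) _ _ (is_series_pairs _ _ (is_series_cot_derivative (2 * m) a Ha))).
    rewrite Hval, pow_1_even in Hs.
    replace (INR (fact (2 * m)) / (2 * a ^ (2 * m + 1)) + _) with
     (/ 2 * (INR (fact (2 * m)) * (1 / a ^ S (2 * m) -
      - (2 * PI * ((-1) ^ m * (2 * PI * INR q) ^ (2 * m)) * (A / INR (fact (2 * m + 1))))))).
    2:{ rewrite Nat.add_1_r, (fact_simpl (2 * m)), mult_INR.
        field. repeat split; auto using INR_fact_neq_0, INR_S_neq0, pow_nonzero. }
    (* In each pair the term of even degree vanishes and the one of odd degree
       [2 i + 1] is twice the term wanted. *)
    apply is_series_ext with (2 := Hs). intros i. cbv zeta. as_eq R.
    replace (2 * i + 2 * m)%nat with (2 * (i + m))%nat by lia.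
    replace (2 * i + 1 + 2 * m)%nat with (S (2 * (i + m))) by lia.
    rewrite cot_coef_even, cot_coef_odd.
    replace (2 * S i + 2 * m - 1)%nat with (S (2 * (i + m))) by lia.
    replace (2 * S i - 1)%nat with (2 * i + 1)%nat by lia.
    replace (2 * S i + 2 * m)%nat with (2 * (i + m) + 2)%nat by lia.
    field. split; apply INR_fact_neq_0.
  - set (A := sum_n_m _ 1 q).
    assert (Hval : cot_taylor (2 * m + 1) a
      = - (2 * PI * ((-1) ^ m * (2 * PI * INR q) ^ (2 * m + 1)) * (A / INR (fact (2 * m + 2))))).
    { specialize (Hc (2 * m + 1)%nat). apply (f_equal Re) in Hc.
      rewrite re_RtoC, Cpow_add_r, two_PI_i_pow, Cpow_1_r in Hc. rewrite Hc.
      replace (delta (2 * m + 1)) with 0 by (destruct m; [lia | reflexivity]).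
      replace (S (2 * m + 1)) with (2 * m + 2)%nat by lia.
      unfold A. rewrite <- (Re_bern_sum B q alpha' (2 * m + 2) Hq), pow_add, pow_1.
      set (beta := bern_sum _ _ _ _). unfold two_PI_i, Re, Im. simpl. field. }
    assert (Hs := is_series_Rscal (/ 2) _ _ (is_series_pairs _ _ (is_series_cot_derivative (2 * m + 1) a Ha))).
    rewrite Hval, (Nat.add_1_r (2 * m)), pow_1_odd in Hs.
    rewrite <- (Nat.add_1_r (2 * m)) in Hs.
    replace (- (INR (fact (2 * m + 1)) / (2 * a ^ (2 * m + 2))) + _) with
     (/ 2 * (INR (fact (2 * m + 1)) * (-1 / a ^ S (2 * m + 1) -
      - (2 * PI * ((-1) ^ m * (2 * PI * INR q) ^ (2 * m + 1)) * (A / INR (fact (2 * m + 2))))))).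
    2:{ replace (2 * m + 2)%nat with (S (2 * m + 1)) by lia.
        rewrite (fact_simpl (2 * m + 1)), mult_INR.
        field. repeat split; auto using INR_fact_neq_0, INR_S_neq0, pow_nonzero. }
    (* Here it is the term of odd degree that vanishes. *)
    apply is_series_ext with (2 := Hs). intros i. cbv zeta. as_eq R.
    replace (2 * i + (2 * m + 1))%nat with (S (2 * (i + m))) by lia.
    replace (2 * i + 1 + (2 * m + 1))%nat with (2 * (i + m + 1))%nat by lia.
    rewrite cot_coef_even, cot_coef_odd.
    replace (2 * S i + 2 * m - 1)%nat with (S (2 * (i + m))) by lia.
    replace (2 * S i - 2)%nat with (2 * i)%nat by lia.
    replace (2 * S i + 2 * m)%nat with (2 * (i + m) + 2)%nat by lia.
    field. split; apply INR_fact_neq_0.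
Qed.
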